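(* There is an algorithm that solves the All-Targets Change-Making problem in $O(u^2\log u + t)$ time, where $u=\max_{1\le i\le n} v_i$ is the largest coin value.
   Context: All-Targets Change-Making: given a set $V=\{v_1,\dots,v_n\}$ of $n$ distinct positive integers (coin values) and a positive integer $t$, output, for every $j=0,1,\dots,t$, the minimum of $\sum_{i=1}^n m_i$ over all $m_1,\dots,m_n\in\mathbb{N}=\{0,1,2,\dots\}$ with $\sum_{i=1}^n m_i v_i=j$ (the minimum number of coins, each coin value usable arbitrarily many times, summing to exactly $j$), or $\infty$ if no such $m_i$ exist. *)

(* Defs.v *)
From mathcomp Require Import all_boot.

Set Implicit Arguments.
Unset Strict Implicit.
Unset Printing Implicit Defensive.

(** * Word RAM

  Word size [w]: registers and memory cells hold numbers below [2 ^ w], all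
  results are reduced modulo [2 ^ w], and every instruction costs one unit of
  time.  A program is a fixed finite list of instructions that depends neither
  on the input nor on [w]; it can name only the finitely many registers
  occurring in it, while [Read] and [Write] address memory indirectly. *)

Inductive binop := OpAdd | OpSub | OpMul | OpDiv | OpMod.

Inductive instr :=
  | Const of nat & nat
  | Move of nat & nat
  | Arith of binop & nat & nat & nat
  | Read of nat & nat
  | Write of nat & nat
  | Jump of nat
  | JumpLt of nat & nat & nat
  | JumpEq of nat & nat & nat.

Definition program := seq instr.

Record state := State { pc : nat; reg : nat -> nat; memory : nat -> nat }.

Definition upd (f : nat -> nat) (i x : nat) : nat -> nat :=
  fun j => if j == i then x else f j.

(* [OpSub] wraps around, as on a machine with unsigned words; division by zero
   follows the conventions of [divn] and [modn]. *)
Definition eval_binop (w : nat) (o : binop) (x y : nat) : nat :=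
  match o with
  | OpAdd => (x + y) %% 2 ^ w
  | OpSub => (x + (2 ^ w - y)) %% 2 ^ w
  | OpMul => (x * y) %% 2 ^ w
  | OpDiv => x %/ y
  | OpMod => x %% y
  end.

Definition exec (w : nat) (i : instr) (s : state) : state :=
  let: State p r m := s in
  match i with
  | Const d k => State p.+1 (upd r d (k %% 2 ^ w)) m
  | Move d a => State p.+1 (upd r d (r a)) m
  | Arith o d a b => State p.+1 (upd r d (eval_binop w o (r a) (r b))) m
  | Read d a => State p.+1 (upd r d (m (r a))) m
  | Write a b => State p.+1 r (upd m (r a) (r b))
  | Jump l => State l r m
  | JumpLt a b l => State (if r a < r b then l else p.+1) r m
  | JumpEq a b l => State (if r a == r b then l else p.+1) r m
  end.

(* The machine has halted when the program counter is outside the program. *)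
Definition halted (P : program) (s : state) : bool := size P <= pc s.

Definition step (w : nat) (P : program) (s : state) : state :=
  if onth P (pc s) is Some i then exec w i s else s.

Definition halts_within (w : nat) (P : program) (s0 : state) (T : nat)
    (post : state -> Prop) : Prop :=
  exists k : nat, [/\ k <= T, halted P (iter k (step w P) s0)
                    & post (iter k (step w P) s0)].

(** * All-Targets Change-Making *)

Definition payable (n : nat) (v : n.-tuple nat) (j k : nat) : Prop :=
  exists m : 'I_n -> nat,
    \sum_(i < n) m i * tnth v i = j /\ \sum_(i < n) m i = k.

(* [None] stands for infinity. *)
Definition min_coins (n : nat) (v : n.-tuple nat) (j : nat) (o : option nat)
    : Prop :=
  if o is Some k
  then payable v j k /\ (forall k', payable v j k' -> k <= k')
  else forall k, ~ payable v j k.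

Definition max_coin (n : nat) (v : n.-tuple nat) : nat :=
  \max_(i < n) tnth v i.

(* The coin values form a set, given in an arbitrary order; [0 < n] is needed
   for the maximum to make sense. *)
Definition valid_instance (n : nat) (v : n.-tuple nat) (t : nat) : Prop :=
  [/\ 0 < n, uniq v, forall i, 0 < tnth v i & 0 < t].

(* Input convention: r_0 = n, r_1 = t, mem[i] = v_i for i < n, and every other
   register and memory cell is 0. *)
Definition input_state (n : nat) (v : n.-tuple nat) (t : nat) : state :=
  State 0 (nth 0 [:: n; t]) (nth 0 v).

(* Output convention: mem[j] holds the code of the answer for target j, where
   infinity is coded by 0 and the number k by k + 1. *)
Definition answer_code (o : option nat) : nat := if o is Some k then k.+1 else 0.

Definition correct_output (n : nat) (v : n.-tuple nat) (t : nat) (s : state)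
    : Prop :=
  forall j, j <= t -> exists o, min_coins v j o /\ memory s j = answer_code o.

(* [P] solves the problem in time [O(T v t)] on machines with words of
   [O(log (u + t))] bits: there is a [K] such that any word size
   [w >= K * log2 (u + t)] is enough. *)
Definition solves_in_O (P : program)
    (T : forall n : nat, n.-tuple nat -> nat -> nat) : Prop :=
  exists K C : nat,
    forall (n : nat) (v : n.-tuple nat) (t w : nat),
      valid_instance v t ->
      (max_coin v + t) ^ K <= 2 ^ w ->
      halts_within w P (input_state v t) (C * T n v t) (correct_output v t).

(* Main.v *)
Require Import Defs.
From mathcomp Require Import all_boot all_fingroup zmodp zify.

Set Implicit Arguments.
Unset Strict Implicit.
Unset Printing Implicit Defensive.

(** Run the textbook dynamic program on the coins in increasing order, but when
  [i > 0] coins larger than the current one remain, fill the table only up to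
  [4 u^2 / i]; only the last coin [u] is run up to [t].  The cost is
  [O(t + sum_i u^2 / i) = O(u^2 log u + t)].

  This loses no optimal payment: if coins [<= c] have total value more than
  [4 u^2 / i], where [A] is the set of the [i] coins larger than [c], then some
  nonempty subcollection of them has a sum payable with [A], and replacing it
  saves coins since those of [A] are larger.  To find it, work modulo [u] in the
  subgroup [H] generated by [A].  By Olson's inequality
  [|X + Y| >= |X| + |Y| / 2] (unless [X + Y] is a union of cosets of the
  subgroup generated by [Y]), sums of [2 u / i + 1] elements of [A] already
  cover [H].  By pigeonhole all but fewer than [u / |H| <= u / i] of the small
  coins can be grouped so that their total lies in [H]; it is large enough to be
  such a sum plus a multiple of [u]. *)

(** * Sumsets in abelian groups *)

Section Olson.
Variable gT : finGroupType.
Implicit Types A B C : {set gT}.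
Local Open Scope group_scope.

(** The right translations preserving [A] form a group, the setwise stabilizer; once it contains [B]
    it contains [<<B>>]. *)
Lemma mulg_gen_stable A B : A * B \subset A -> A * <<B>> \subset A.
Proof.
move=> sABA; have sB : <<B>> \subset 'N(A | 'R).
  rewrite gen_subG; apply/subsetP=> b Bb; rewrite !inE /=.
  by apply/subsetP=> a Aa; rewrite inE /= (subsetP sABA) // mem_mulg.
apply/subsetP=> _ /mulsgP[a x Aa /(subsetP sB) Nx ->].
by rewrite -[_ * _]/('R%act a x) (astabs_act _ Nx).
Qed.

Hypothesis cT : forall x y : gT, commute x y.

(** While some [a * b] falls outside [A], pass to [A :|: a *: B] and [B :&: a^-1 *: A]: the total
    size is kept, the product set does not grow, and the second set shrinks. *)
Lemma dyson_transform A B : 1 \in B ->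
  exists A' B', [/\ A \subset A', 1 \in B', A' * B' \subset A * B,
    A' * B' \subset A' & (#|A'| + #|B'| = #|A| + #|B|)%N].
Proof.
have [m] := ubnP #|B|; elim: m A B => // m IHm A B ltBm B1.
have [sABA | /subsetPn[_ /mulsgP[a b Aa Bb ->] nAab]] := boolP (A * B \subset A).
  by exists A, B.
pose A1 := A :|: a *: B; pose B1' := B :&: a^-1 *: A.
have B11 : 1 \in B1' by rewrite inE B1 mem_lcoset invgK mulg1.
have cardB1 : #|B1'| = #|A :&: a *: B|.
  rewrite -(card_lcoset B1' a); apply: eq_card => x.
  by rewrite !(inE, mem_lcoset) invgK mulKVg andbC.
have ltB1 : (#|B1'| < #|B|)%N.
  apply/proper_card/properP; split; first exact: subsetIl.
  by exists b => //; rewrite !(inE, mem_lcoset) invgK negb_and nAab orbT.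
have [A' [B' [sA1A' B'1 sA'B' stabA' eqc]]] :=
  IHm A1 B1' (leq_trans ltB1 ltBm) B11.
exists A', B'; split=> //.
- exact: subset_trans (subsetUl _ _) sA1A'.
- apply: subset_trans sA'B' _; apply/subsetP=> _ /mulsgP[x y X Y ->].
  move: X Y; rewrite !(inE, mem_lcoset) => /orP[Ax|Bx] /andP[By].
    by rewrite mem_mulg.
  rewrite invgK => Ay; apply/mulsgP; exists (a * y) (a^-1 * x) => //.
  by rewrite [a * y]cT mulgA mulgK cT.
- by rewrite eqc cardB1 cardsUI card_lcoset.
Qed.

(* Olson's theorem.  If [|AB| < |A| + |B|/2], the transformed [B'] has more than
   half the size of [B], so [AB] gains less than [#|K|] elements over [A], where
   [K = <<B'>>]; this forces [AB = AK]. *)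
Lemma olson A B : 1 \in B ->
  A * B = A * <<B>> \/ (2 * #|A| + #|B| <= 2 * #|(A * B)%g|)%N.
Proof.
move=> B1; have [|ltC] := leqP (2 * #|A| + #|B|)%N (2 * #|(A * B)%g|)%N.
  by right.
left; have [A' [B' [sAA' B'1 sA'B' stabA' eqc]]] := dyson_transform A B1.
have sA'C : A' \subset A * B.
  by apply: subset_trans sA'B'; apply/subsetP=> x A'x; rewrite -[x]mulg1 mem_mulg.
set K := <<B'>>; have leB'K : (#|B'| <= #|K|)%N := subset_leq_card (subset_gen B').
have leA'C := subset_leq_card sA'C.
have sAKC : A * K \subset A * B.
  apply: subset_trans (subset_trans (mulSg _ sAA') (mulg_gen_stable stabA')) sA'C.
have sCAK : A * B \subset A * K.
  apply/subsetP=> c Cc; apply: contraLR ltC => nc; rewrite -leqNgt.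
  have /mulsgP[a b Aa Bb def_c] := Cc.
  (* Since [c = a * b] lies outside [A * K], so does all of [Y], and [A * B] has at least
     [#|A| + #|K|] elements. Averaging this with the bound by [#|A'|] contradicts [ltC]. *)
  pose Y := (A :&: a *: K) :* b.
  have sYC : Y \subset A * B.
    apply/subsetP=> y /rcosetP[x /setIP[Ax _] ->]; exact: mem_mulg.
  have dY : [disjoint A * K & Y].
    apply/pred0P=> y /=; apply/negP=> /andP[/mulsgP[a' k' Aa' Kk' ->]].
    case/rcosetP=> x /setIP[Ax /lcosetP[k Kk ->]] E; case/negP: nc.
    apply/mulsgP; exists a' (k' * k^-1); rewrite ?groupM ?groupV //.
    by rewrite mulgA E def_c -!mulgA (cT k) mulgKV.
  have sUC : A * K :|: Y \subset A * B by rewrite subUset sAKC.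
  have := subset_leq_card sUC.
  rewrite cardsU (eqP (_ : A * K :&: Y == set0)) ?setI_eq0 // cards0.
  rewrite card_rcoset.
  have : A :|: a *: K \subset A * K.
    rewrite subUset -{1}[A]mulg1 mulgS ?sub1G //=.
    by apply/subsetP=> _ /lcosetP[k Kk ->]; rewrite mem_mulg.
  move/subset_leq_card; have := cardsUI A (a *: K); rewrite card_lcoset.
  have arith x y z k x' y' i r p : (x' + y' = x + y -> y' <= k -> x' <= z ->
    r + i = x + k -> r <= p -> p + i - 0 <= z -> 2 * x + y <= 2 * z)%N by lia.
  by move=> e1 e2 e3; apply: (arith _ _ _ _ _ _ _ _ _ eqc leB'K leA'C e1 e2 e3).
have defC : A * B = A * K by apply/eqP; rewrite eqEsubset sCAK.
(* Here [A * B * B = A * K * B = A * B * K = A * B], so [A * B] absorbs all of [<<B>>]. *)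
have stabC : A * B * B \subset A * B.
  have cK : K * B = B * K.
    by apply/setP=> z; apply/idP/idP=> /mulsgP[x y X Y ->]; rewrite cT mem_mulg.
  by rewrite {1}defC -mulgA cK mulgA defC -mulgA mulGid.
apply/eqP; rewrite eqEsubset mulgS ?subset_gen //=.
apply: subset_trans (mulg_gen_stable stabC); apply: mulSg.
by apply/subsetP=> x Ax; rewrite -[x]mulg1 mem_mulg.
Qed.

(** By [olson], each further factor [B] either completes [<<B>>] or adds at least [#|B| / 2]
    elements; [k] such additions would overflow [<<B>>]. *)
Lemma gen_expset B k : 1 \in B -> (2 * #|<<B>>| < 2 + k * #|B|)%N ->
  B ^+ k = <<B>>.
Proof.
move=> B1; have sk m : B ^+ m \subset <<B>>.
  elim: m => [|m IHm]; first by rewrite expg0 sub1G.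
  by rewrite expgS mul_subG ?subset_gen.
have H : B ^+ k = <<B>> \/ (2 + k * #|B| <= 2 * #|(B ^+ k)%g|)%N.
  elim: k => [|k IHk]; first by right; rewrite expg0 cards1.
  have Bk1 m : 1 \in B ^+ m.
    by elim: m => [|m IHm]; rewrite ?expg0 ?set11 // expgS -[1]mulg1 mem_mulg.
  rewrite expgSr; case: (olson (B ^+ k) B1) => [->|le1].
    left; apply/eqP; rewrite eqEsubset mul_subG //=.
    by apply/subsetP=> x Bx; rewrite -[x]mul1g mem_mulg.
  case: IHk => [->|le2]; last first.
    by right; apply: leq_trans le1; rewrite mulSn addnCA addnC leq_add2r.
  left; apply/eqP; rewrite eqEsubset mul_subG ?subset_gen //=.
  by apply/subsetP=> x Bx; rewrite -[x]mulg1 mem_mulg.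
case: H => // le1 lt1; have := leq_trans lt1 le1.
by rewrite ltn_pmul2l // ltnNge subset_leq_card.
Qed.


Variable f : nat -> gT.
Hypothesis fD : {morph f : m n / (m + n)%N >-> m * n}.

(** The [size b + 1] prefix sums, the empty one included, outnumber the cosets of [H]; two prefixes
    in one coset delimit the block [b1]. *)
Lemma zero_sum_block (H : {group gT}) (b : seq nat) :
  (#|[set: gT] : H| <= size b)%N ->
  exists b1 b2 : seq nat,
    [/\ b1 != [::], perm_eq b (b1 ++ b2) & f (sumn b1) \in H].
Proof.
move=> leHb; pose p (i : 'I_(size b).+1) := H :* f (sumn (take i b)).
have /injectivePn[i [j neq_ij eq_p]] : ~~ injectiveb p.
  apply/negP=> /injectiveP p_inj.
  have E := card_imset [set: 'I_(size b).+1] p_inj.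
  have : p @: [set: 'I_(size b).+1] \subset rcosets H [set: gT].
    by apply/subsetP=> _ /imsetP[i _ ->]; apply/rcosetsP; exists (f (sumn (take i b))).
  by move/subset_leq_card; rewrite {}E cardsT card_ord leqNgt ltnS => /negP[].
wlog lt_ij : i j neq_ij eq_p / (i < j)%N.
  move=> W; case: (ltngtP i j) => [|lt_ji|/val_inj eq_ij]; first exact: W.
  - by apply: (W j i) => //; rewrite eq_sym.
  - by rewrite eq_ij eqxx in neq_ij.
have le_jb : (j <= size b)%N by rewrite -ltnS.
pose b1 := take (j - i) (drop i b).
have def_b : b = take i b ++ b1 ++ drop j b.
  rewrite -{1}(cat_take_drop i b); congr (_ ++ _).
  rewrite -{1}(cat_take_drop (j - i) (drop i b)); congr (_ ++ _).
  by rewrite drop_drop subnK // ltnW.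
have sz_b1 : size b1 = (j - i)%N.
  by rewrite size_takel // size_drop leq_sub2r.
exists b1, (take i b ++ drop j b); split.
- by rewrite -size_eq0 sz_b1 subn_eq0 -ltnNge.
- by rewrite {1}def_b perm_catCA.
have def_j : take j b = take i b ++ b1.
  by rewrite -takeD subnKC // ltnW.
move: eq_p; rewrite /p def_j sumn_cat fD => /esym/rcoset_eqP.
by rewrite mem_rcoset cT mulKg.
Qed.

(** Blocks given by [zero_sum_block] are removed until fewer numbers remain than [H] has cosets. *)
Lemma split_sum_in_subgroup (H : {group gT}) (b : seq nat) : f 0 = 1 ->
  exists b1 b2 : seq nat, [/\ perm_eq b (b1 ++ b2), f (sumn b1) \in H
    & (size b2 < #|[set: gT] : H|)%N].
Proof.
move=> f0; have [m] := ubnP (size b); elim: m b => // m IHm b ltbm.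
have [ltb|leb] := ltnP (size b) #|[set: gT] : H|.
  by exists [::], b; rewrite f0.
have [b1 [b2 [b1n0 eq_b Hb1]]] := zero_sum_block leb.
have szb : size b = (size b1 + size b2)%N by rewrite (perm_size eq_b) size_cat.
have [|c1 [c2 [eq_b2 Hc1 ltc2]]] := IHm b2.
  move: b1n0 ltbm; rewrite -size_eq0 szb -lt0n ltnS => b1_gt0.
  by apply: leq_trans; rewrite -[X in (X < _)%N]add0n ltn_add2r.
exists (b1 ++ c1), c2; split=> //; last by rewrite sumn_cat fD groupM.
by rewrite (permPl eq_b) -catA perm_cat2l.
Qed.

End Olson.

(** * Exchange argument on payments *)

Lemma leq_sumn_size (m : nat) (s : seq nat) :
  all (leq^~ m) s -> sumn s <= size s * m.
Proof. by elim: s => //= x s IHs /andP[lex /IHs]; lia. Qed.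

(* With [S] the residues of [A] modulo [u], Olson's theorem makes every residue
   in the subgroup [<<S>>] a sum of [2 * u %/ size A + 1] elements of [A]. *)
Lemma large_sum_representable (u : nat) (A b : seq nat) :
  uniq A -> {in A, forall a, 0 < a <= u} -> u \in A -> all (leq^~ u) b ->
  4 * u ^ 2 < size A * sumn b ->
  exists b1 b2 a : seq nat, [/\ perm_eq b (b1 ++ b2), b1 != [::],
    {subset a <= A} & sumn a = sumn b1].
Proof.
move=> uA Ale Au leb ltb; have u_gt0 : 0 < u by case/andP: (Ale _ Au).
case: u u_gt0 Ale Au leb ltb => // u _ Ale Au leb ltb.
(* The group law of ['I_u.+1] is addition modulo [u.+1], which now stands for the original [u]. *)
pose f (x : nat) : 'I_u.+1 := inZp x.
have cI : forall x y : 'I_u.+1, commute x y.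
  by move=> x y; apply: val_inj; rewrite /= addnC.
have fD : {morph f : m n / (m + n)%N >-> (m * n)%g}.
  by move=> m n; apply: val_inj; rewrite /= modnDm.
have f0 : f 0 = 1%g by apply: val_inj.
pose S := [set x in map f A].
(* The largest coin supplies the neutral element of [S] that Olson's theorem requires. *)
have fu : f u.+1 = 1%g by apply: val_inj; rewrite /= modnn.
have S1 : 1%g \in S by rewrite inE -fu map_f.
have fI : {in A &, injective f}.
  move=> x y /Ale/andP[x0 xu] /Ale/andP[y0 yu] /(congr1 val) /= /eqP.
  wlog lexy : x y x0 xu y0 yu / x <= y.
    move=> W E; case/orP: (leq_total x y) => [/W|/W W']; first exact.
    by apply/esym/W' => //; rewrite eq_sym.
  rewrite eq_sym eqn_mod_dvd // => /dvdnP[[|q] E]; first by lia.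
  by move: E; rewrite mulSn; lia.
have cS : #|S| = size A.
  rewrite cardsE -(size_map f A); apply/card_uniqP.
  by rewrite map_inj_in_uniq.
have leSH : #|S| <= #|<<S>>%g| := subset_leq_card (subset_gen S).
have LH : #|<<S>>%g| * #|[set: 'I_u.+1] : <<S>>|%g = u.+1.
  have := Lagrange (subsetT <<S>>%G); rewrite cardsT card_ord; exact.
have [b1 [b2 [eq_b Hb1 ltb2]]] := split_sum_in_subgroup cI fD <<S>>%G b f0.
set g := #|_ : _|%g in ltb2; rewrite -/g in LH.
set k := 2 * u.+1 %/ size A + 1.
have A_gt0 : 0 < size A by case: (A) Au.
have leHu : #|<<S>>%g| <= u.+1.
  by rewrite -[X in _ <= X]card_ord max_card.
have ltk : 2 * u.+1 < k * size A by rewrite /k addn1 ltn_ceil.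
have Sk : (S ^+ k)%g = <<S>>%g.
  by apply: gen_expset => //; rewrite cS; lia.
have repr m x : x \in (S ^+ m)%g ->
    exists a : seq nat, [/\ {subset a <= A}, size a = m & f (sumn a) = x].
  elim: m x => [|m IHm] x.
    by rewrite expg0 => /set1P->; exists [::].
  rewrite expgS => /mulsgP[y z]; rewrite inE.
  move=> /mapP[c Ac ->] /IHm[a [sa sz <-]] ->.
  exists (c :: a); split; rewrite /= ?sz ?fD //.
  by move=> d; rewrite inE => /orP[/eqP->|/sa].
move: Hb1; rewrite -[val _]/<<S>>%g -Sk => /repr[a [sa sz_a fa]].
have lea : sumn a <= k * u.+1.
  rewrite -sz_a; apply: leq_sumn_size; apply/allP=> x /sa/Ale.
  by case/andP.
have leb2 : sumn b2 <= g.-1 * u.+1.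
  apply: leq_trans (leq_sumn_size (m := u.+1) _) _.
    apply/allP=> x b2x; apply: (allP leb).
    by rewrite (perm_mem eq_b) mem_cat b2x orbT.
  by rewrite leq_mul // -ltnS (ltn_predK ltb2).
have sumb : sumn b = sumn b1 + sumn b2 by rewrite (perm_sumn eq_b) sumn_cat.
have kA : k * size A <= 2 * u.+1 + size A.
  by rewrite /k mulnDl mul1n leq_add2r leq_trunc_div.
have leAu : size A <= u.+1 by rewrite -cS (leq_trans leSH).
have gA : g * size A <= u.+1.
  by rewrite -[X in _ <= X]LH mulnC leq_mul2r -cS leSH orbT.
clearbody g k.
(* Write [U] for [u.+1]. Otherwise [size A * sumn b1 <= 2 * U ^ 2 + size A * U] and
   [size A * sumn b2 <= U ^ 2 - size A * U], in total at most [3 * U ^ 2], against [ltb]. *)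
have ltab : k * u.+1 < sumn b1.
  rewrite ltnNge; apply/negP=> leb1.
  have h1 : size A * sumn b1 <= 2 * u.+1 ^ 2 + size A * u.+1.
    apply: leq_trans (leq_mul (leqnn _) leb1) _.
    by rewrite mulnA (mulnC _ k) expnS expn1 mulnA -mulnDl leq_mul2r kA orbT.
  have h2 : size A * sumn b2 + size A * u.+1 <= u.+1 ^ 2.
    rewrite -mulnDr expnS expn1; apply: leq_trans (leq_mul gA (leqnn _)).
    rewrite (mulnC g) -mulnA leq_mul2l; apply/orP; right.
    rewrite -[X in _ <= X * _](ltn_predK ltb2) mulSn addnC.
    by rewrite leq_add2l.
  have h3 : size A * u.+1 <= u.+1 ^ 2 by rewrite expnS expn1 leq_mul2r leAu orbT.
  by move: ltb; rewrite sumb mulnDr; lia.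
have leab : sumn a <= sumn b1 := leq_trans lea (ltnW ltab).
have /dvdnP[q Eq] : u.+1 %| sumn b1 - sumn a.
  rewrite -eqn_mod_dvd //; apply/eqP.
  by move/(congr1 val): fa => /= ->.
(* The sums of [a] and [b1] agree modulo the largest coin, so copies of that coin, itself in [A],
   make up the difference. *)
exists b1, b2, (nseq q u.+1 ++ a); split=> //.
- by apply: contraTneq ltab => ->.
- move=> x; rewrite mem_cat => /orP[/nseqP[-> _] //|/sa //].
- by rewrite sumn_cat sumn_nseq mulnC -Eq subnK.
Qed.

Lemma improve_large_small_part (V s : seq nat) (u c : nat) :
  uniq V -> {in V, forall a, 0 < a <= u} -> u \in V -> {subset s <= V} ->
  let A := [seq x <- V | c < x] in
  c < u ->
  4 * u ^ 2 %/ size A < sumn [seq x <- s | x <= c] ->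
  exists s' : seq nat,
    [/\ {subset s' <= V}, sumn s' = sumn s & size s' < size s].
Proof.
move=> uV Vle Vu sV A ltcu lts.
have A_gt0 : 0 < size A.
  have : u \in A by rewrite mem_filter ltcu.
  by case: (A).
pose b := [seq x <- s | x <= c].
have [||||| b1 [b2 [a [eq_b b1n0 sa sum_a]]]] := @large_sum_representable u A b.
- exact: filter_uniq.
- by move=> x; rewrite mem_filter => /andP[_ /Vle].
- by rewrite mem_filter ltcu.
- apply/allP=> x; rewrite mem_filter => /andP[lex _].
  exact: leq_trans lex (ltnW ltcu).
- by rewrite (mulnC (size A)) -ltn_divLR.
have eq_s : perm_eq s (b1 ++ b2 ++ [seq x <- s | c < x]).
  rewrite catA; apply: perm_trans (perm_cat eq_b (perm_refl _)).
  rewrite perm_sym (eq_filter (a2 := predC (leq^~ c))) ?perm_filterC //.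
  by move=> x /=; rewrite ltnNge.
exists (a ++ b2 ++ [seq x <- s | c < x]); split.
- move=> x; rewrite mem_cat => /orP[/sa|xs].
    by rewrite mem_filter => /andP[].
  by apply: sV; rewrite (perm_mem eq_s) mem_cat xs orbT.
- by rewrite (perm_sumn eq_s) !sumn_cat sum_a.
- rewrite (perm_size eq_s) !size_cat ltn_add2r.
  have leb1 : sumn b1 <= size b1 * c.
    apply: leq_sumn_size; apply/allP=> x b1x.
    have : x \in b by rewrite (perm_mem eq_b) mem_cat b1x.
    by rewrite mem_filter => /andP[].
  have gea : size a * c.+1 <= sumn a.
    elim: (a) sa => //= x a' IHa sa.
    rewrite mulSn leq_add // ?IHa //; last first.
      by move=> y ya; apply: sa; rewrite inE ya orbT.
    by have := sa x (mem_head _ _); rewrite mem_filter => /andP[].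
  (* Otherwise [size b1 * c.+1 <= sumn a = sumn b1 <= size b1 * c], which forces [b1] to be
     empty. *)
  rewrite ltnNge; apply: contra b1n0 => leba; rewrite -size_eq0 -leqn0.
  have := leq_trans (leq_trans (leq_mul leba (leqnn c.+1)) gea).
  by rewrite sum_a => /(_ _ leb1); rewrite mulnS -[X in _ <= X]add0n leq_add2r.
Qed.

Definition larger (V : seq nat) (c : nat) : nat := count (fun x => c < x) V.

(* Bounds the total value of the coins of value at most [c] in an optimal
   payment of a target [<= t]. *)
Definition prefix_limit (V : seq nat) (u t c : nat) : nat :=
  if larger V c == 0 then t else 4 * u ^ 2 %/ larger V c.

(** Bounding every threshold up to [c], not [c] alone, makes the condition inherited by the stages
    of smaller coins. *)
Definition thrifty (V : seq nat) (u t c : nat) (s : seq nat) : Prop :=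
  forall d, d <= c -> sumn [seq x <- s | x <= d] <= prefix_limit V u t d.

Lemma leq_sumn_filter (a : pred nat) (s : seq nat) :
  sumn (filter a s) <= sumn s.
Proof. by elim: s => //= x s IHs; case: (a x) => /=; lia. Qed.

(** The exchange is repeated as long as some threshold is violated; it terminates because each
    exchange lowers the number of coins. *)
Lemma thrifty_solution (V : seq nat) (u t : nat) (s : seq nat) :
  uniq V -> {in V, forall a, 0 < a <= u} -> u \in V ->
  {subset s <= V} -> sumn s <= t ->
  exists s' : seq nat, [/\ {subset s' <= V}, sumn s' = sumn s,
    size s' <= size s & forall c, thrifty V u t c s'].
Proof.
move=> uV Vle Vu; have [m] := ubnP (size s); elim: m s => // m IHm s ltsm sV les.
have lim_large d : u <= d -> prefix_limit V u t d = t.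
  move=> leud; rewrite /prefix_limit (_ : larger V d = 0) //.
  apply/eqP; rewrite -leqn0 leqNgt -has_count; apply/negP=> /hasP[x /Vle].
  by lia.
have [/allP ok|/allPn[d]] :=
    boolP (all (fun d => sumn [seq x <- s | x <= d] <= prefix_limit V u t d)
               (iota 0 u)).
  exists s; split=> // c d _; have [ltdu|leud] := ltnP d u.
    by apply: ok; rewrite mem_iota.
  by rewrite lim_large // (leq_trans (leq_sumn_filter _ _)).
rewrite mem_iota add0n -ltnNge => ltdu; rewrite /prefix_limit.
have -> : (larger V d == 0) = false.
  by apply/negbTE; rewrite -lt0n -has_count; apply/hasP; exists u.
rewrite /larger -size_filter => lts.
have [s' [s'V sum_s' lt_s']] := improve_large_small_part uV Vle Vu sV ltdu lts.
have [|||s1 [s1V sum1 sz1 thr1]] := IHm s'; rewrite ?sum_s' //.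
  exact: leq_trans lt_s' _.
by exists s1; split; rewrite // ?sum1 // (leq_trans sz1) // ltnW.
Qed.

(** * The dynamic program *)

(** Entries come from actual payments, perhaps not minimal ones; 0 codes infinity. The bound [X]
    excludes the cells that hold the coin marks. *)
Definition sound (V : seq nat) (D : nat -> nat) (X : nat) : Prop :=
  forall j, j <= X -> 0 < D j ->
    exists s : seq nat, [/\ {subset s <= V}, sumn s = j & D j = (size s).+1].

Definition complete (V : seq nat) (u t c : nat) (D : nat -> nat) : Prop :=
  forall s : seq nat, {subset s <= V} -> all (leq^~ c) s -> thrifty V u t c s ->
    0 < D (sumn s) <= (size s).+1.

(* The state of the table while coin [c] is processed, all targets below [j]
   having been treated. *)
Definition partially_complete (V : seq nat) (u t c j : nat) (D : nat -> nat) :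
    Prop :=
  forall s : seq nat, {subset s <= V} -> all (leq^~ c) s -> thrifty V u t c s ->
    (c \notin s) || (sumn s < j) -> 0 < D (sumn s) <= (size s).+1.

(** This is the update of [D j] to the minimum of [D j] and [D (j - c) + 1], with 0 read as
    infinity, in a form that every branch of the program can meet. *)
Definition relaxed (c j : nat) (D D' : nat -> nat) : Prop :=
  [/\ forall i, i != j -> D' i = D i,
      D' j = D j \/ 0 < D (j - c) /\ D' j = (D (j - c)).+1,
      0 < D j -> 0 < D' j <= D j
    & 0 < D (j - c) -> 0 < D' j <= (D (j - c)).+1].

Lemma sound_relaxed (V : seq nat) (D D' : nat -> nat) (X c j : nat) :
  c \in V -> c <= j -> relaxed c j D D' -> sound V D X -> sound V D' X.
Proof.
move=> Vc lecj [eqD' D'j _ _] sD i leiX.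
have [eij | neij] := eqVneq i j; last by rewrite eqD' //; apply: sD.
rewrite {i}eij in leiX *; case: D'j => [->|[Djc ->] _]; first exact: sD.
have [|s [sV sum_s ->]] := sD (j - c) _ Djc.
  exact: leq_trans (leq_subr _ _) leiX.
exists (c :: s); split=> //=; last by rewrite sum_s subnKC.
by move=> x; rewrite inE => /orP[/eqP->|/sV].
Qed.

(** Coins are at least 1, so [j] needs at most [j] of them; hence table entries fit in a word. *)
Lemma sound_le (V : seq nat) (D : nat -> nat) (X j : nat) :
  {in V, forall a, 0 < a} -> sound V D X -> j <= X -> D j <= j.+1.
Proof.
move=> Vpos sD leX; case: (posnP (D j)) => [->//|/(sD j leX)[s [sV <- ->]]].
rewrite ltnS; elim: s sV => //= x s IHs sV.
have := Vpos x (sV x (mem_head _ _)).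
have /IHs : {subset s <= V} by move=> y sy; apply: sV; rewrite inE sy orbT.
by lia.
Qed.

Lemma thrifty_rem (V : seq nat) (u t c x : nat) (s : seq nat) :
  thrifty V u t c s -> thrifty V u t c (rem x s).
Proof.
move=> thr d ledc; apply: leq_trans (thr d ledc).
elim: s {thr} => //= y s IHs; case: eqP => _; first by case: ifP => //= _; lia.
by rewrite /=; case: ifP => //= _; lia.
Qed.

(** Removing one coin [c] from a payment of [j] leaves a thrifty payment of [j - c < j], whose entry
    is already final for this round. *)
Lemma partially_complete_relaxed (V : seq nat) (u t c j : nat)
    (D D' : nat -> nat) :
  0 < c -> c <= j -> relaxed c j D D' ->
  partially_complete V u t c j D -> partially_complete V u t c j.+1 D'.
Proof.
move=> c_gt0 lecj [eqD' _ D'le D'lec] pD s sV sc thr sj.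
have [eqj | neqj] := eqVneq (sumn s) j; last first.
  rewrite eqD' //; apply: pD => //; move: sj neqj; rewrite ltnS leq_eqVlt.
  by case/orP=> [->//|/orP[->|->]]; rewrite ?orbT.
have [cs | ncs] := boolP (c \in s); last first.
  have := pD s sV sc thr; rewrite ncs eqj => /(_ isT) /andP[/D'le/andP[-> le1]].
  exact: leq_trans.
have sum_s : sumn s = c + sumn (rem c s) by rewrite (perm_sumn (perm_to_rem cs)).
have sub : {subset rem c s <= s} by apply: mem_subseq; apply: rem_subseq.
have eq1 : sumn (rem c s) = j - c by rewrite -eqj sum_s addKn.
have /andP[/D'lec/andP[D'j_gt0 leD'j] leDj] :
    0 < D (j - c) <= (size (rem c s)).+1.
  rewrite -eq1; apply: pD.
  - by move=> x /sub/sV.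
  - by apply/allP=> x /sub/(allP sc).
  - exact: thrifty_rem.
  - by apply/orP; right; lia.
by rewrite eqj D'j_gt0 (leq_trans leD'j) // (perm_size (perm_to_rem cs)).
Qed.

Lemma partially_complete_start (V : seq nat) (u t c : nat) (D : nat -> nat) :
  complete V u t c D -> partially_complete V u t c.+1 c.+1 D.
Proof.
move=> cD s sV sc thr; case/orP=> [ncs|lts].
  apply: cD => //; last by move=> d ledc; apply: thr; apply: leqW.
  apply/allP=> x sx; have := allP sc x sx; rewrite leq_eqVlt ltnS => /orP[/eqP xc|//].
  by rewrite -xc sx in ncs.
apply: cD => //; last by move=> d ledc; apply: thr; apply: leqW.
elim: s lts {sV sc thr} => //= x s IHs lts; rewrite IHs; lia.
Qed.

(** Truncating the round loses nothing: thriftiness at [c] already bounds the whole sum by the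
    limit. *)
Lemma partially_complete_end (V : seq nat) (u t c j : nat) (D : nat -> nat) :
  prefix_limit V u t c < j -> partially_complete V u t c j D ->
  complete V u t c D.
Proof.
move=> ltj pD s sV sc thr; apply: pD => //; apply/orP; right.
apply: leq_ltn_trans ltj; have := thr c (leqnn c).
by rewrite (_ : [seq x <- s | x <= c] = s) //; apply/all_filterP.
Qed.

Lemma complete_skip (V : seq nat) (u t c : nat) (D : nat -> nat) :
  c.+1 \notin V -> complete V u t c D -> complete V u t c.+1 D.
Proof.
move=> ncV cD s sV sc thr; apply: cD => //; last first.
  by move=> d ledc; apply: thr; apply: leqW.
apply/allP=> x sx; have := allP sc x sx; rewrite leq_eqVlt ltnS => /orP[/eqP xc|//].
by rewrite -xc sV in ncV.
Qed.

(** * Summing the lengths of the rounds *)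

Lemma larger_step (V : seq nat) (c : nat) :
  uniq V -> larger V c = (c.+1 \in V) + larger V c.+1.
Proof.
move=> uV; rewrite -(count_uniq_mem _ uV) /larger.
by elim: V {uV} => //= x V ->; lia.
Qed.

Lemma leq_larger (V : seq nat) (k : nat) : larger V k <= larger V 0.
Proof. by apply: sub_count => x /=; lia. Qed.

(** Each coin passed lowers the count of larger coins by exactly one, so that count reindexes the
    sum. *)
Lemma sum_over_coins (V : seq nat) (g : nat -> nat) (k : nat) : uniq V ->
  \sum_(c < k | c.+1 \in V) g (larger V c.+1) =
  \sum_(larger V k <= r < larger V 0) g r.
Proof.
move=> uV; elim: k => [|k IHk]; first by rewrite big_ord0 big_geq.
rewrite big_mkcond big_ord_recr -big_mkcond /= {}IHk.
have := leq_larger V k; rewrite (larger_step k uV).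
case: (k.+1 \in V) => le0; last by rewrite addn0 add0n.
by rewrite add1n in le0 *; rewrite [RHS]big_ltn 1?addnC.
Qed.

(** Each of the [k] dyadic blocks contributes at most [M]: it has [2 ^ i] terms, none above
    [M %/ 2 ^ i]. *)
Lemma sum_divn_harmonic (M k : nat) : \sum_(1 <= r < 2 ^ k) M %/ r <= k * M.
Proof.
elim: k => [|k IHk]; first by rewrite big_geq.
rewrite (big_cat_nat (n := 2 ^ k)) ?expn_gt0 //=; last by rewrite leq_exp2l.
rewrite mulSn addnC leq_add //.
have : \sum_(2 ^ k <= r < 2 ^ k.+1) M %/ r <=
    \sum_(2 ^ k <= r < 2 ^ k.+1) M %/ 2 ^ k.
  rewrite big_nat [X in _ <= X]big_nat; apply: leq_sum => r /andP[ler _].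
  by rewrite leq_div2l // expn_gt0.
move/leq_trans; apply; rewrite sum_nat_const_nat expnS.
rewrite (_ : 2 * 2 ^ k - 2 ^ k = 2 ^ k); last by lia.
by rewrite mulnC leq_trunc_div.
Qed.

(** * Running time logic *)

(** Halting is not demanded here, so the bounds of consecutive program segments add up. *)
Definition reach (w : nat) (P : program) (s : state) (T : nat)
    (Q : state -> Prop) : Prop :=
  exists2 k, k <= T & Q (iter k (step w P) s).

Section Reach.
Variables (w : nat) (P : program).
Implicit Types (T : nat) (Q : state -> Prop) (r m : nat -> nat).

Lemma reach_now s T Q : Q s -> reach w P s T Q.
Proof. by exists 0. Qed.

Lemma reach_le s T T' Q : T <= T' -> reach w P s T Q -> reach w P s T' Q.
Proof. by move=> leT [k lek Qk]; exists k => //; apply: leq_trans leT. Qed.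

Lemma reach_trans s T1 T2 Q1 Q2 : reach w P s T1 Q1 ->
  (forall s', Q1 s' -> reach w P s' T2 Q2) -> reach w P s (T1 + T2) Q2.
Proof.
move=> [k1 le1 /[swap]/[apply] -[k2 le2 Qk]].
by exists (k2 + k1); rewrite ?iterD // addnC leq_add.
Qed.

Lemma reach_loop n (c : nat -> nat) (I : nat -> state -> Prop) s :
  (forall i s', i < n -> I i s' -> reach w P s' (c i) (I i.+1)) ->
  I 0 s -> reach w P s (\sum_(i < n) c i) (I n).
Proof.
move=> Istep I0; elim: n Istep => [|n IHn] Istep; first exact: reach_now.
rewrite big_ord_recr; apply: reach_trans (IHn _) _ => [i s' lti|s'].
  by apply: Istep; apply: ltnW.
exact: Istep.
Qed.

Lemma reach_step p r m T Q i : onth P p = Some i ->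
  reach w P (exec w i (State p r m)) T Q -> reach w P (State p r m) T.+1 Q.
Proof.
move=> Pi [k lek Qk]; exists k.+1 => //.
by rewrite iterSr /step /= Pi.
Qed.

(** From here on, one symbolic execution rule per instruction; the side conditions rule out
    wraparound, so results are plain arithmetic. *)
Lemma reach_const p r m T Q d k : onth P p = Some (Const d k) -> k < 2 ^ w ->
  reach w P (State p.+1 (upd r d k) m) T Q -> reach w P (State p r m) T.+1 Q.
Proof. by move=> Pp ltk R; apply: reach_step Pp _; rewrite /exec modn_small. Qed.

Lemma reach_move p r m T Q d a x : onth P p = Some (Move d a) -> r a = x ->
  reach w P (State p.+1 (upd r d x) m) T Q -> reach w P (State p r m) T.+1 Q.
Proof. by move=> Pp <- R; apply: reach_step Pp _. Qed.

Lemma reach_add p r m T Q d a b x y : onth P p = Some (Arith OpAdd d a b) ->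
  r a = x -> r b = y -> x + y < 2 ^ w ->
  reach w P (State p.+1 (upd r d (x + y)) m) T Q ->
  reach w P (State p r m) T.+1 Q.
Proof.
by move=> Pp <- <- lt R; apply: reach_step Pp _; rewrite /exec /= modn_small.
Qed.

Lemma reach_mul p r m T Q d a b x y : onth P p = Some (Arith OpMul d a b) ->
  r a = x -> r b = y -> x * y < 2 ^ w ->
  reach w P (State p.+1 (upd r d (x * y)) m) T Q ->
  reach w P (State p r m) T.+1 Q.
Proof.
by move=> Pp <- <- lt R; apply: reach_step Pp _; rewrite /exec /= modn_small.
Qed.

Lemma reach_sub p r m T Q d a b x y : onth P p = Some (Arith OpSub d a b) ->
  r a = x -> r b = y -> y <= x -> x < 2 ^ w ->
  reach w P (State p.+1 (upd r d (x - y)) m) T Q ->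
  reach w P (State p r m) T.+1 Q.
Proof.
move=> Pp <- <- le lt R; apply: reach_step Pp _; rewrite /exec /=.
rewrite addnBA 1?(leq_trans le) 1?ltnW // addnC -addnBA // modnDl.
by rewrite modn_small // (leq_ltn_trans (leq_subr _ _)).
Qed.

Lemma reach_div p r m T Q d a b x y : onth P p = Some (Arith OpDiv d a b) ->
  r a = x -> r b = y ->
  reach w P (State p.+1 (upd r d (x %/ y)) m) T Q ->
  reach w P (State p r m) T.+1 Q.
Proof. by move=> Pp <- <- R; apply: reach_step Pp _. Qed.

Lemma reach_read p r m T Q d a x : onth P p = Some (Read d a) -> r a = x ->
  reach w P (State p.+1 (upd r d (m x)) m) T Q -> reach w P (State p r m) T.+1 Q.
Proof. by move=> Pp <- R; apply: reach_step Pp _. Qed.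

Lemma reach_write p r m T Q a b x y : onth P p = Some (Write a b) ->
  r a = x -> r b = y ->
  reach w P (State p.+1 r (upd m x y)) T Q -> reach w P (State p r m) T.+1 Q.
Proof. by move=> Pp <- <- R; apply: reach_step Pp _. Qed.

Lemma reach_jump p r m T Q l : onth P p = Some (Jump l) ->
  reach w P (State l r m) T Q -> reach w P (State p r m) T.+1 Q.
Proof. by move=> Pp R; apply: reach_step Pp _. Qed.

Lemma reach_jlt p r m T Q a b l x y : onth P p = Some (JumpLt a b l) ->
  r a = x -> r b = y ->
  (x < y -> reach w P (State l r m) T Q) ->
  (y <= x -> reach w P (State p.+1 r m) T Q) -> reach w P (State p r m) T.+1 Q.
Proof.
by move=> Pp <- <- R1 R2; apply: reach_step Pp _; rewrite /exec; case: ltnP.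
Qed.

Lemma reach_jeq p r m T Q a b l x y : onth P p = Some (JumpEq a b l) ->
  r a = x -> r b = y ->
  (x = y -> reach w P (State l r m) T Q) ->
  (x <> y -> reach w P (State p.+1 r m) T Q) -> reach w P (State p r m) T.+1 Q.
Proof.
by move=> Pp <- <- R1 R2; apply: reach_step Pp _; rewrite /exec; case: eqP.
Qed.

End Reach.

(* Registers: r0 = number of coins larger than r8, r1 = t, r2 = 0, r3 = 1,
   r4 = u, r7 = 4 u^2 + t, r8 = current coin, r9 = limit for that coin,
   r10 = current target, r13 = 4 u^2.  The table of answers occupies the cells
   up to [r7], and the cell [r7 + c] tells whether [c] is a coin value. *)
Definition prog : program :=
  [:: Const 3 1;
      (* 1: compute u *)
      JumpEq 5 0 7;
      Read 6 5;
      JumpLt 6 4 5;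
      Move 4 6;
      Arith OpAdd 5 5 3;
      Jump 1;
      Const 13 4;
      Arith OpMul 13 13 4;
      Arith OpMul 13 13 4;
      Arith OpAdd 7 13 1;
      Const 5 0;
      (* 12: mark the coin values and erase the input *)
      JumpEq 5 0 19;
      Read 6 5;
      Write 5 2;
      Arith OpAdd 6 6 7;
      Write 6 3;
      Arith OpAdd 5 5 3;
      Jump 12;
      Write 2 3;
      (* 20: next coin *)
      JumpEq 8 4 41;
      Arith OpAdd 8 8 3;
      Arith OpAdd 6 8 7;
      Read 6 6;
      JumpEq 6 2 20;
      Arith OpSub 0 0 3;
      Move 9 1;
      JumpEq 0 2 29;
      Arith OpDiv 9 13 0;
      Move 10 8;
      (* 30: next target *)
      JumpLt 9 10 20;
      Arith OpSub 11 10 8;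
      Read 11 11;
      JumpEq 11 2 39;
      Arith OpAdd 11 11 3;
      Read 12 10;
      JumpEq 12 2 38;
      JumpLt 12 11 39;
      Write 10 11;
      Arith OpAdd 10 10 3;
      Jump 30].

Definition regs (r : nat -> nat) (l : seq nat) : seq nat := [seq r i | i <- l].

Ltac get_reg := rewrite /upd /=; first [eassumption | reflexivity].
Ltac set_regs := rewrite /regs /upd /=; congr [:: _; _; _; _; _; _; _] => //.

(** * Correctness and running time of the program *)

Section Run.
Variables (n : nat) (v : n.-tuple nat) (t w : nat).
Hypothesis Hv : valid_instance v t.

Let V : seq nat := v.
Let u := max_coin v.
Let X := 4 * u * u + t.

Lemma max_coinE : u = \max_(x <- V) x.
Proof. by rewrite /V big_tuple. Qed.

Lemma uniqV : uniq V. Proof. by case: Hv. Qed.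

Lemma V_le : {in V, forall a, 0 < a <= u}.
Proof.
move=> a Va; rewrite max_coinE (leq_bigmax_seq (F := fun x => x)) // andbT.
by case/tnthP: Va => i ->; case: Hv.
Qed.

Lemma u_in_V : u \in V.
Proof.
have n_gt0 : 0 < n by case: Hv.
rewrite /u /max_coin (bigmax_eq_arg (Ordinal n_gt0)) //; exact: mem_tnth.
Qed.

Lemma u_gt0 : 0 < u. Proof. by case/andP: (V_le u_in_V). Qed.

Lemma leq_n_u : n <= u.
Proof.
have : size V <= size (iota 1 u).
  apply: uniq_leq_size uniqV _ => x /V_le; rewrite mem_iota; lia.
by rewrite size_tuple size_iota.
Qed.

Hypothesis Hw : (max_coin v + t) ^ 6 <= 2 ^ w.

(** With [z = u + t >= 2], the exponent 6 gives [z ^ 6 >= 16 * z ^ 2], enough room for all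
    addresses, counters and table entries. *)
Lemma word_bound : X + u + 3 < 2 ^ w.
Proof.
apply: leq_trans Hw; rewrite -/u /X.
have t_gt0 : 0 < t by case: Hv.
have := u_gt0; set z := u + t => u0.
have z2 : 2 <= z by rewrite /z; lia.
have le16 : 16 * (z * z) <= z ^ 6.
  rewrite (_ : z ^ 6 = z ^ 4 * (z * z)); last by rewrite mulnn -expnD.
  by apply: leq_mul => //; rewrite (_ : 16 = 2 ^ 4) ?leq_exp2r.
apply: leq_trans le16.
have : u * u <= z * z by apply: leq_mul; rewrite /z; lia.
have : 2 * z <= z * z by apply: leq_mul.
by rewrite /z; lia.
Qed.

Definition max_inv (i : nat) (s : state) : Prop :=
  [/\ pc s = 1,
      regs (reg s) [:: 0; 1; 2; 3; 4; 5; 8] =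
        [:: n; t; 0; 1; \max_(x <- take i V) x; i; 0]
    & memory s =1 nth 0 V].

Lemma max_loop : reach w prog (input_state v t) (1 + \sum_(i < n) 6) (max_inv n).
Proof.
apply: (reach_trans (Q1 := max_inv 0)).
  apply: reach_const => //; first by have := word_bound; lia.
  by apply: reach_now; split=> //; rewrite take0 big_nil.
move=> s0; apply: (reach_loop (c := fun=> 6)) => {s0} i [p r m] lti.
case=> /= -> [e0 e1 e2 e3 e4 e5 e8] em.
have szV : size V = n by rewrite size_tuple.
have E : \max_(x <- take i.+1 V) x = maxn (nth 0 V i) (\max_(x <- take i V) x).
  by rewrite (take_nth 0) ?szV // big_rcons maxnC.
have lt1 : i + 1 < 2 ^ w by have := word_bound; have := leq_n_u; lia.
apply: reach_jeq; [done|get_reg|get_reg|lia|move=> _].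
apply: reach_read; [done|get_reg|].
apply: reach_jlt; [done|get_reg|get_reg|move=> lt|move=> ge].
- apply: reach_add; [done|get_reg|get_reg|done|].
  apply: reach_jump; first done.
  apply: reach_now; split=> //; set_regs; rewrite ?addn1 // E e4.
  by move: lt; rewrite /upd /= em => /ltnW/maxn_idPr.
- apply: reach_move; [done|get_reg|].
  apply: reach_add; [done|get_reg|get_reg|done|].
  apply: reach_jump; first done.
  apply: reach_now; split=> //; set_regs; rewrite ?addn1 // E em.
  by move: ge; rewrite /upd /= em => /maxn_idPl.
Qed.

(** The input lies in cells below [n <= X], so marks, written above [X], never overwrite a coin
    still to be read. *)
Definition mark_inv (i : nat) (s : state) : Prop :=
  [/\ pc s = 12,
      regs (reg s) [:: 0; 1; 2; 3; 4; 5; 7; 8; 13] =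
        [:: n; t; 0; 1; u; i; X; 0; 4 * u * u],
      forall j, j <= X -> memory s j = if j < i then 0 else nth 0 V j
    & forall c, 0 < c -> memory s (X + c) = (c \in take i V)].

Lemma mark_start s : max_inv n s -> reach w prog s 6 (mark_inv 0).
Proof.
case: s => p r m [/= -> [e0 e1 e2 e3 e4 e5 e8] em].
have szV : size V = n by rewrite size_tuple.
rewrite -szV take_size -max_coinE in e4; have B := word_bound; have u0 := u_gt0.
have ltX : 4 * u * u < 2 ^ w by apply: leq_ltn_trans B; rewrite /X; lia.
have ltu : 4 * u < 2 ^ w.
  by apply: leq_ltn_trans ltX; rewrite leq_pmulr // u_gt0.
apply: reach_jeq; [done|get_reg|get_reg|move=> _|done].
apply: reach_const; [done|lia|].
apply: reach_mul; [done|get_reg|get_reg|done|].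
apply: reach_mul; [done|get_reg|get_reg|done|].
apply: reach_add; [done|get_reg|get_reg| |].
  by apply: leq_ltn_trans B; rewrite /X; lia.
apply: reach_const; [done|lia|].
apply: reach_now; split=> //=.
  by rewrite /regs /upd /= e0 e1 e2 e3 e4 e8.
move=> c c_gt0; rewrite em take0 nth_default // szV.
have := leq_n_u; have := u_gt0; rewrite /X; nia.
Qed.

Lemma mark_step i s : i < n -> mark_inv i s -> reach w prog s 7 (mark_inv i.+1).
Proof.
case: s => p r m lti [/= -> [e0 e1 e2 e3 e4 e5 e7 e8 e13] mlo mhi].
have B := word_bound; have le_nX : n <= X.
  by have := leq_n_u; have := u_gt0; rewrite /X; nia.
have szV : size V = n by rewrite size_tuple.
have mi : m i = nth 0 V i by rewrite mlo ?ltnn //; lia.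
have Vi : nth 0 V i \in V by rewrite mem_nth ?szV.
have /andP[Vi_gt0 Vi_le] := V_le Vi.
apply: reach_jeq; [done|get_reg|get_reg|lia|move=> _].
apply: reach_read; [done|get_reg|].
apply: reach_write; [done|get_reg|get_reg|].
apply: reach_add; [done|get_reg|get_reg|rewrite ?mi; lia|].
apply: reach_write; [done|get_reg|get_reg|].
apply: reach_add; [done|get_reg|get_reg|lia|].
apply: reach_jump; first done.
apply: reach_now; split=> //=.
- by rewrite /regs /upd /= e0 e1 e2 e3 e4 e7 e8 e13 addn1.
- move=> j leX; rewrite /upd ?mi.
  case: eqP => [|_]; first by lia.
  case: eqP => [->|neji]; first by rewrite ltnS leqnn.
  by rewrite mlo // (_ : (j < i.+1) = (j < i)) //; lia.
- move=> c c_gt0; rewrite /upd ?mi (take_nth 0) ?szV // mem_rcons inE.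
  rewrite (addnC (nth 0 V i)) eqn_add2l.
  case: eqP => //= _; rewrite (_ : (X + c == i) = false) ?mhi //; lia.
Qed.

Definition coin_inv (c : nat) (s : state) : Prop :=
  [/\ pc s = 20,
      regs (reg s) [:: 0; 1; 2; 3; 4; 7; 8; 13] =
        [:: larger V c; t; 0; 1; u; X; c; 4 * u * u],
      forall d, 0 < d -> memory s (X + d) = (d \in V),
      sound V (memory s) X
    & complete V u t c (memory s)].

Lemma coin_start s : mark_inv n s -> reach w prog s 2 (coin_inv 0).
Proof.
case: s => p r m [/= -> [e0 e1 e2 e3 e4 e5 e7 e8 e13] mlo mhi].
have szV : size V = n by rewrite size_tuple.
have m0 j : j <= X -> m j = 0.
  by move/mlo->; case: ltnP => // gej; rewrite nth_default // szV.
apply: reach_jeq; [done|get_reg|get_reg|move=> _|done].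
apply: reach_write; [done|get_reg|get_reg|].
apply: reach_now; split=> //=.
- rewrite /regs /= e0 e1 e2 e3 e4 e7 e8 e13 /larger -[in LHS]szV.
  by congr (_ :: _); apply/esym/eqP; rewrite -all_count; apply/allP=> x /V_le/andP[].
- move=> d d_gt0; rewrite /upd mhi // -szV take_size.
  by case: eqP => //; lia.
(* The only nonzero entry is cell 0, with code 1 for the empty payment. *)
- move=> j leX; rewrite /upd; case: eqP => [->|_]; last by rewrite m0.
  by exists [::].
- move=> s sV s0 _; rewrite (_ : s = [::]) //.
  case: s sV s0 => // x s sV /= /andP[x0 _].
  by have /V_le := sV x (mem_head _ _); lia.
Qed.

Definition target_inv (c j : nat) (s : state) : Prop :=
  [/\ pc s = 30,
      regs (reg s) [:: 0; 1; 2; 3; 4; 7; 8; 9; 10; 13] =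
        [:: larger V c; t; 0; 1; u; X; c; prefix_limit V u t c; j; 4 * u * u],
      forall d, 0 < d -> memory s (X + d) = (d \in V),
      sound V (memory s) X
    & partially_complete V u t c j (memory s)].

(** A truncated round may run past [t], hence a table up to [X] and not just [t]. *)
Lemma prefix_limit_le c : prefix_limit V u t c <= X.
Proof.
rewrite /prefix_limit /X; case: eqP => _; first exact: leq_addl.
by rewrite (leq_trans (leq_div _ _)) // -mulnn mulnA leq_addr.
Qed.

Lemma target_step c j s : c \in V -> c <= j <= prefix_limit V u t c ->
  target_inv c j s -> reach w prog s 11 (target_inv c j.+1).
Proof.
move=> Vc /andP[lecj lejl].
case: s => p r m [/= -> [e0 e1 e2 e3 e4 e7 e8 e9 e10 e13] mark snd pc_j].
have B := word_bound; have lejX := leq_trans lejl (prefix_limit_le c).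
have c_gt0 : 0 < c by case/andP: (V_le Vc).
have Vpos : {in V, forall a, 0 < a} by move=> a /V_le/andP[].
have ltjc : m (j - c) + 1 < 2 ^ w.
  have := sound_le Vpos snd (leq_trans (leq_subr c j) lejX); lia.
(* All branches share this tail; [k] is slack for those shorter than the longest one of 11
   instructions. *)
have finish m' k r' : relaxed c j m m' ->
    (forall i, i != j -> m' i = m i) ->
    regs r' [:: 0; 1; 2; 3; 4; 7; 8; 9; 10; 13] =
      regs r [:: 0; 1; 2; 3; 4; 7; 8; 9; 10; 13] ->
    reach w prog (State 39 r' m') k.+2 (target_inv c j.+1).
  move=> rel eqm; rewrite /regs /= e0 e1 e2 e3 e4 e7 e8 e9 e10 e13.
  case=> f0 f1 f2 f3 f4 f7 f8 f9 f10 f13.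
  apply: reach_add; [done|get_reg|get_reg|lia|].
  apply: reach_jump; first done.
  apply: reach_now; split=> //=.
  - by rewrite /regs /upd /= f0 f1 f2 f3 f4 f7 f8 f9 f13 addn1.
  - by move=> d d_gt0; rewrite eqm ?mark //; lia.
  - exact: sound_relaxed rel snd.
  - exact: partially_complete_relaxed rel pc_j.
apply: reach_jlt; [done|get_reg|get_reg|lia|move=> _].
apply: reach_sub; [done|get_reg|get_reg|done|lia|].
apply: reach_read; [done|get_reg|].
apply: reach_jeq; [done|get_reg|get_reg|move=> mz|move/eqP; rewrite -lt0n => mp].
  by apply: finish => //; split=> //; [left|move=> ->/=|rewrite mz].
apply: reach_add; [done|get_reg|get_reg|done|].
apply: reach_read; [done|get_reg|].
have write r' : r' 10 = j -> r' 11 = m (j - c) + 1 ->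
    (0 < m j -> m (j - c) + 1 <= m j) ->
    regs r' [:: 0; 1; 2; 3; 4; 7; 8; 9; 10; 13] =
      regs r [:: 0; 1; 2; 3; 4; 7; 8; 9; 10; 13] ->
    reach w prog (State 38 r' m) 3 (target_inv c j.+1).
  move=> g10 g11 lem eqr.
  apply: reach_write; [done|get_reg|get_reg|].
  apply: finish => //; last by move=> i neij; rewrite /upd (negbTE neij).
  split; rewrite /upd ?eqxx.
  - by move=> i neij; rewrite (negbTE neij).
  - by right; rewrite addn1.
  - by move/lem; rewrite addn1.
  - by rewrite addn1 ltnSn.
apply: reach_jeq; [done|get_reg|get_reg|move=> mz|move=> mjp].
  by apply: reach_le (write _ _ _ _ _) => //; rewrite ?mz.
apply: reach_jlt; [done|get_reg|get_reg|move=> lt|move=> ge].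
  apply: finish => //; split; [done|by left| |]; lia.
by apply: write.
Qed.

Lemma target_loop c s : c \in V -> target_inv c c s ->
  reach w prog s (11 * (prefix_limit V u t c).+1) (coin_inv c).
Proof.
move=> Vc Is; set l := prefix_limit V u t c.
have c_gt0 : 0 < c by case/andP: (V_le Vc).
(* The truncated subtraction covers a limit below [c]: there are no iterations and the final counter
   [c] still exceeds [l]. *)
have loop : reach w prog s (\sum_(i < l.+1 - c) 11) (target_inv c (c + (l.+1 - c))).
  apply: (reach_loop (c := fun=> 11) (I := fun i => target_inv c (c + i))).
    move=> i s' lti; rewrite addnS; apply: target_step => //.
    by apply/andP; split; rewrite -?/l; lia.
  by rewrite addn0.
apply: (@reach_le _ _ _ (\sum_(i < l.+1 - c) 11 + 1)).
  by rewrite sum_nat_const card_ord; lia.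
apply: reach_trans loop _ => -[p r m].
case=> /= -> [e0 e1 e2 e3 e4 e7 e8 e9 e10 e13] mark snd pc_j.
apply: reach_jlt; [done|get_reg|get_reg|move=> lt|rewrite -/l; lia].
apply: reach_now; split=> //=; first by rewrite /regs /= e0 e1 e2 e3 e4 e7 e8 e13.
exact: partially_complete_end lt pc_j.
Qed.

Lemma coin_step c s : c < u -> coin_inv c s ->
  reach w prog s
    (21 + (if c.+1 \in V then 11 * prefix_limit V u t c.+1 else 0))
    (coin_inv c.+1).
Proof.
case: s => p r m ltcu [/= -> [e0 e1 e2 e3 e4 e7 e8 e13] mark snd compl].
have B := word_bound; have mc := mark c.+1 isT.
have larger_le : larger V c <= n.
  by rewrite -(size_tuple v); apply: count_size.
have le_nu := leq_n_u.
have := larger_step c uniqV; move: mc; case: ifP => Vc mc eqL.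
all: apply: reach_jeq; [done|get_reg|get_reg|lia|move=> _].
all: apply: reach_add; [done|get_reg|get_reg|lia|].
all: apply: reach_add; [done|get_reg|get_reg|lia|].
all: apply: reach_read; [done|get_reg|].
all: rewrite addn1 (addnC c.+1 X) mc.
all: apply: reach_jeq; [done|get_reg|get_reg| |] => // _.
  (* The constant 21 is 5 instructions already spent, at most 5 to set up the round, and 11 from the
     successor in [target_loop]. *)
  apply: (@reach_le _ _ _ (5 + 11 * (prefix_limit V u t c.+1).+1)); first by lia.
  apply: (@reach_trans _ _ _ _ _ (target_inv c.+1 c.+1)); last first.
    by move=> s'; apply: target_loop.
  have eqL' : larger V c - 1 = larger V c.+1 by lia.
  apply: reach_sub; [done|get_reg|get_reg|lia|lia|].
  apply: reach_move; [done|get_reg|].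
  rewrite eqL'.
  apply: reach_jeq; [done|get_reg|get_reg|move=> L0|move=> L0].
    apply: reach_move; [done|get_reg|].
    apply: reach_now; split=> //=; last exact: partially_complete_start.
    by rewrite /regs /upd /= e1 e2 e3 e4 e7 e13 /prefix_limit L0.
  apply: reach_div; [done|get_reg|get_reg|].
  apply: reach_move; [done|get_reg|].
  apply: reach_now; split=> //=; last exact: partially_complete_start.
  rewrite /regs /upd /= e1 e2 e3 e4 e7 e13 /prefix_limit.
  by case: eqP => // _; rewrite -mulnn mulnA.
apply: reach_now; split=> //=; last by apply: complete_skip; rewrite ?Vc.
by rewrite /regs /upd /= e0 e1 e2 e3 e4 e7 e13 eqL.
Qed.

Definition run_time : nat :=
  1 + 6 * n + (6 + (7 * n + (2 +
    (\sum_(c < u) (21 + (if c.+1 \in V then 11 * prefix_limit V u t c.+1 else 0))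
     + 1)))).

Lemma run_correct : reach w prog (input_state v t) run_time
  (fun s => [/\ pc s = 41, sound V (memory s) X & complete V u t u (memory s)]).
Proof.
have sum_const k : \sum_(i < n) k = k * n.
  by rewrite sum_nat_const card_ord mulnC.
have := max_loop; rewrite sum_const /run_time => loop1.
apply: reach_trans loop1 _ => s /mark_start start2; apply: reach_trans start2 _.
move=> s2 I2; have loop2 := reach_loop (c := fun=> 7) mark_step I2.
rewrite sum_const in loop2; apply: reach_trans loop2 _.
move=> s3 /coin_start start3; apply: reach_trans start3 _.
move=> s4 I3; have loop3 := reach_loop coin_step I3.
apply: reach_trans loop3 _ => -[p r m].
case=> /= -> [e0 e1 e2 e3 e4 e7 e8 e13] mark snd compl.
apply: reach_jeq; [done|get_reg|get_reg|move=> _|done].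
by apply: reach_now; split.
Qed.

(** Indexed by the number [r] of larger coins, the rounds cost [t] for [r = 0] and [4 * u ^ 2 %/ r]
    otherwise, up to constants: a harmonic sum over [L.+1] dyadic blocks. *)
Lemma run_time_le : run_time <= 200 * (u ^ 2 * trunc_log 2 u + t).
Proof.
clear Hw.
have t_gt0 : 0 < t by case: Hv.
have le_nu := leq_n_u; have u0 := u_gt0.
pose g r := if r == 0 then t else 4 * u ^ 2 %/ r.
have sum_lim : \sum_(c < u) (21 + (if c.+1 \in V then 11 * prefix_limit V u t c.+1
    else 0)) = 21 * u + 11 * \sum_(0 <= r < n) g r.
  rewrite big_split /= sum_nat_const card_ord mulnC; congr (_ + _).
  rewrite -big_mkcond -big_distrr /=; congr (_ * _).
  have := sum_over_coins g u uniqV.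
  rewrite (_ : larger V u = 0); last first.
    by apply/eqP; rewrite -leqn0 leqNgt -has_count; apply/hasPn=> x /V_le; lia.
  rewrite (_ : larger V 0 = n) // -[RHS](size_tuple v); apply/eqP.
  by rewrite -all_count; apply/allP=> x /V_le/andP[].
rewrite /run_time sum_lim big_ltn; last by case: Hv.
have -> : \sum_(1 <= r < n) g r = \sum_(1 <= r < n) 4 * u ^ 2 %/ r.
  by apply: eq_big_nat => -[].
rewrite /g /=; set S := \sum_(_ <= _ < _) _; set L := trunc_log 2 u.
(* For [u = 1] the logarithm vanishes, but then [n <= 1], the sum [S] is empty and [t > 0] absorbs
   the constants. *)
have [u1|u_gt1] : u = 1 \/ 1 < u by lia.
  have -> : S = 0 by rewrite /S big_geq // -u1.
  by rewrite u1 in le_nu *; lia.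
have L_gt0 : 0 < L by rewrite trunc_log_gt0.
have leS : S <= L.+1 * (4 * u ^ 2).
  apply: leq_trans (sum_divn_harmonic _ _).
  have ltn : n <= 2 ^ L.+1.
    by apply: leq_trans le_nu _; apply/ltnW/trunc_log_ltn.
  case: (posnP n) => [n0|n_gt0]; first by rewrite /S n0 big_geq.
  by rewrite (big_cat_nat (n := n) (p := 2 ^ L.+1)) //= leq_addr.
have le_u : u <= u ^ 2 * L.
  by rewrite -mulnn -mulnA leq_pmulr // muln_gt0 u0.
have leL : L.+1 * (4 * u ^ 2) <= 8 * (u ^ 2 * L).
  rewrite (mulnC _ L) mulnCA mulnA mulnA leq_mul2r; apply/orP; right; lia.
lia.
Qed.

End Run.

(** * From the final table to minimum payments *)

Lemma payable_seq n (v : n.-tuple nat) j k : payable v j k ->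
  exists s : seq nat, [/\ {subset s <= v}, sumn s = j & size s = k].
Proof.
case=> m [<- <-]; exists (flatten [seq nseq (m i) (tnth v i) | i <- index_enum 'I_n]).
split.
- by move=> x /flatten_mapP[i _ /nseqP[-> _]]; apply: mem_tnth.
- rewrite sumn_flatten sumnE !big_map; apply: eq_bigr => i _.
  by rewrite sumn_nseq mulnC.
- rewrite size_flatten sumnE /shape !big_map; apply: eq_bigr => i _.
  by rewrite size_nseq.
Qed.

Lemma seq_payable n (v : n.-tuple nat) (s : seq nat) :
  {subset s <= v} -> payable v (sumn s) (size s).
Proof.
elim: s => [|x s IHs] sv.
  by exists (fun=> 0); split; rewrite big1.
have [|m [sum_m size_m]] := IHs; first by move=> y sy; apply: sv; rewrite inE sy orbT.
have /tnthP[i0 ->] := sv x (mem_head _ _).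
exists (fun i => (i == i0) + m i); split.
- under eq_bigr do rewrite mulnDl.
  rewrite big_split /= sum_m (bigD1 i0) //= eqxx mul1n big1 ?addn0 //.
  by move=> i /negbTE->.
- rewrite big_split /= size_m (bigD1 i0) //= eqxx big1 //.
  by move=> i /negbTE->.
Qed.

(** Every payment is matched by a thrifty one with no more coins, so completeness bounds the entry
    from above; soundness makes it attained. *)
Lemma complete_table_correct n (v : n.-tuple nat) t X s :
  valid_instance v t -> t <= X ->
  sound v (memory s) X -> complete v (max_coin v) t (max_coin v) (memory s) ->
  correct_output v t s.
Proof.
move=> Hv letX snd compl j lejt; set D := memory s in snd compl *.
have low k : payable v j k -> 0 < D j <= k.+1.
  case/payable_seq=> s0 [s0v sum0 <-].
  have le0 : sumn s0 <= t by rewrite sum0.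
  have [s' [s'v sum' size' thr]] :=
    thrifty_solution (uniqV Hv) (V_le Hv) (u_in_V Hv) s0v le0.
  have all' : all (leq^~ (max_coin v)) s'.
    by apply/allP=> x /s'v/(V_le Hv)/andP[].
  have := compl s' s'v all' (thr _); rewrite sum' sum0 => /andP[-> le1] /=.
  exact: leq_trans le1 _.
case Dj : (D j) => [|k].
  by exists None; split=> // k /low; rewrite Dj.
exists (Some k); split=> //; split.
  have [|s0 [s0v sum0]] := snd j (leq_trans lejt letX); first by rewrite Dj.
  by rewrite Dj -sum0 => -[->]; apply: seq_payable.
by move=> k' /low; rewrite Dj.
Qed.

(* [trunc_log 2 u] is the integer part of the base 2 logarithm; it is 0 for
   u = 1 and at least half of the logarithm for u >= 2, so that the class O(-)
   is the same as with the real logarithm. *)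
Theorem theorem2 :
  exists P : program,
    solves_in_O P
      (fun (n : nat) (v : n.-tuple nat) (t : nat) =>
         max_coin v ^ 2 * trunc_log 2 (max_coin v) + t).
Proof.
exists prog, 6, 200 => n v t w Hv Hw.
have [k lek [pck snd compl]] := run_correct Hv Hw.
exists k; split; first exact: leq_trans lek (run_time_le Hv).
- by rewrite /halted pck.
- apply: complete_table_correct Hv _ snd compl; exact: leq_addl.
Qed.
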